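(* Let $E$ be the smooth plane cubic over $\mathbb{C}$ with affine equation $y^2=f(x)$, $f(x)=x^3+ax^2+bx+c$ ($a,b,c\in\mathbb{C}$), with point at infinity $O=[0,1,0]$, and let $\dot{+}$ be the group law on $E$ with zero element $O$. Let $\mathfrak{d}=\sum_{i=1}^d P_i$ ($d\ge 1$) be an effective divisor on $E$ with $P_i\in E\setminus\{O\}$ not necessarily distinct, such that $P_{\mathfrak{d}}:=P_1\dot{+}\cdots\dot{+}P_d=(x_{\mathfrak{d}},y_{\mathfrak{d}})$ is a torsion point of order $n\ge 2$. Let $b_{\mathfrak{d}}=b_0(x)+b_1(x)y\in\mathbb{C}[x,y]$ define a rational function on $E$ with divisor $(b_{\mathfrak{d}})=\mathfrak{d}+\iota^*P_{\mathfrak{d}}-(d+1)O$, and let $\xi=\xi_0(x)+\xi_1(x)y\in\mathbb{C}[x,y]$ define a rational function on $E$ with divisor $(\xi)=nP_{\mathfrak{d}}-nO$ (where $b_0,b_1,\xi_0,\xi_1\in\mathbb{C}[x]$). Write $\mathrm{NF}_1(b_{\mathfrak{d}}^n\,\xi)=c_0(x)+c_1(x)y$ with $c_0,c_1\in\mathbb{C}[x]$. Then $$b_{n\mathfrak{d}}:=\frac{c_0(x)+c_1(x)y}{(x-x_{\mathfrak{d}})^n}$$ is a polynomial in $\mathbb{C}[x,y]$, and the plane curve $D_{b_{n\mathfrak{d}}}$ that it defines is a weak $n$-contact curve to $E$ with $$D_{b_{n\mathfrak{d}}}|_E=n\mathfrak{d}+(3d_1-nd)O,$$ where $d_1=\deg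 b_{n\mathfrak{d}}$ is the total degree of $b_{n\mathfrak{d}}$.
   Context: $\iota:E\to E$ is the involution $(x,y)\mapsto(x,-y)$ fixing $O$; for a point $P$, $\iota^*P=\iota(P)$. For a rational function $\varphi$ on $E$, $(\varphi)$ denotes its principal divisor. For $g\in\mathbb{C}[x,y]$, $\mathrm{NF}_1(g)$ is the unique polynomial of the form $r_0(x)+r_1(x)y$, $r_i\in\mathbb{C}[x]$, congruent to $g$ modulo the ideal $\langle y^2-f\rangle$ (the remainder of $g$ on division by $y^2-f$ for the lexicographic order with $y>x$). For a polynomial $g\in\mathbb{C}[x,y]$ of total degree $r\ge 1$, the plane curve $D_g\subset\mathbb{P}^2$ defined by $g=0$ is the degree $r$ curve given by the homogenization $Z^r g(X/Z,Y/Z)=0$. For a plane curve $D$ not containing $E$, $D|_E$ is the divisor on $E$ cut out by $D$ (intersection points counted with intersection multiplicity). A plane curve $D$ is called a weak $n$-contact curve to $E$ if $D|_E=n\left(\sum_{i=1}^d P_i\right)+sO$ for some points $P_i\in E$ (not necessarily distinct) and some integer $s\ge 0$; it is called an $n$-contact curve to $E$ if one can take $s=0$. *)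

(* Defs.v *)
From HB Require Import structures.
From mathcomp Require Import all_boot all_order all_algebra.
From mathcomp Require Import ring.
From mathcomp Require Import fraction complex reals.
From mathcomp Require Import freeg mpoly.

Set Implicit Arguments.
Unset Strict Implicit.
Unset Printing Implicit Defensive.

Import GRing.Theory.
Local Open Scope ring_scope.

(* K[x,y] is {poly {poly K}}: the inner variable is x, the outer one is y.
   Hence r(x) is r%:P, y is 'X, and g`_i`_j is the coefficient of x^j y^i. *)

Definition cubic (K : fieldType) (a b c : K) : {poly K} :=
  'X^3 + a *: 'X^2 + b *: 'X + c%:P.

(* y^2 - f is monic in y, so %% is Euclidean division in K[x][y], which is
   division with remainder for the lexicographic order with y > x. *)
Definition NF1 (K : fieldType) (f : {poly K}) (g : {poly {poly K}}) :
    {poly {poly K}} :=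
  g %% ('X^2 - f%:P).

Lemma NF1_spec (K : fieldType) (f : {poly K}) (g : {poly {poly K}}) :
  (exists q, g = q * ('X^2 - f%:P) + NF1 f g) /\
  (exists r0 r1 : {poly K}, NF1 f g = r0%:P + r1%:P * 'X).
Proof.
have Wm : ('X^2 - f%:P) \is monic by rewrite monicXnsubC.
have sW : size ('X^2 - f%:P) = 3%N by rewrite size_XnsubC.
split; first by exists (g %/ ('X^2 - f%:P)); apply: Pdiv.IdomainMonic.divp_eq.
have sN : (size (NF1 f g) <= 2)%N.
  by rewrite -ltnS -sW ltn_modp monic_neq0.
exists (NF1 f g)`_0, (NF1 f g)`_1.
apply/polyP => -[|[|i]]; rewrite coefD coefC coefMX ?coefC /= ?addr0 ?add0r //.
by rewrite nth_default // (leq_trans sN).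
Qed.

Definition tdeg (K : fieldType) (g : {poly {poly K}}) : nat :=
  \max_(i < size g) \max_(j < size (g`_i)%R | ((g`_i)%R`_j)%R != 0%R) (i + j).

(* Plane curves are given by forms in K[X,Y,Z]. *)

Definition pX (K : fieldType) : {mpoly K[3]} := 'X_(inord 0).
Definition pY (K : fieldType) : {mpoly K[3]} := 'X_(inord 1).
Definition pZ (K : fieldType) : {mpoly K[3]} := 'X_(inord 2).

(* Z^r g(X/Z, Y/Z), where r is the total degree of g *)
Definition homogenize (K : fieldType) (g : {poly {poly K}}) : {mpoly K[3]} :=
  \sum_(i < size g) \sum_(j < size g`_i)
     g`_i`_j *: (pX K ^+ j * pY K ^+ i * pZ K ^+ (tdeg g - (i + j))).

Definition is_plane_curve (K : fieldType) (G : {mpoly K[3]}) : Prop :=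
  G <> 0 /\ exists2 r : nat, (0 < r)%N & G \is r.-homog.

Definition weierstrass (K : fieldType) (a b c : K) : {mpoly K[3]} :=
  pY K ^+ 2 * pZ K
  - (pX K ^+ 3 + a *: (pX K ^+ 2 * pZ K) + b *: (pX K * pZ K ^+ 2)
     + c *: pZ K ^+ 3).

Definition smooth_curve (K : fieldType) (F : {mpoly K[3]}) : Prop :=
  forall v : 'I_3 -> K, (exists i, v i <> 0) -> F.@[v] = 0 ->
    exists i : 'I_3, (F^`M(i)).@[v] <> 0.

(* Points of E: None is O = [0,1,0], and Some (x,y) is [x,y,1]. *)

Definition affpoint (K : fieldType) (a b c : K) :=
  {p : K * K | p.2 ^+ 2 == (cubic a b c).[p.1]}.

Definition point (K : fieldType) (a b c : K) := option (affpoint a b c).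

Lemma inv_on_curve (K : fieldType) (a b c : K) (p : affpoint a b c) :
  (- (val p).2) ^+ 2 == (cubic a b c).[(val p).1].
Proof. by rewrite sqrrN (valP p). Qed.

Definition iota_E (K : fieldType) (a b c : K) (P : point a b c) : point a b c :=
  omap (fun p => exist (fun q : K * K => q.2 ^+ 2 == (cubic a b c).[q.1])
                       ((val p).1, - (val p).2) (inv_on_curve p)) P.

(* For affine points that are not opposite: the slope of the chord, or of the
   tangent if the points are equal, and the resulting sum. *)
Definition slope (K : fieldType) (a b : K) (p q : K * K) : K :=
  if p.1 == q.1 then (3%:R * p.1 ^+ 2 + 2%:R * a * p.1 + b) / (2%:R * p.2)
  else (q.2 - p.2) / (q.1 - p.1).

Definition chord_tangent (K : fieldType) (a b : K) (p q : K * K) : K * K :=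
  let l := slope a b p q in
  let x := l ^+ 2 - a - p.1 - q.1 in
  (x, - (p.2 + l * (x - p.1))).

Lemma chord_tangent_on_curve (K : fieldType) (a b c : K) (p q : affpoint a b c) :
  (2%:R : K) != 0 ->
  ~~ (((val p).1 == (val q).1) && ((val p).2 == - (val q).2)) ->
  (chord_tangent a b (val p) (val q)).2 ^+ 2
    == (cubic a b c).[(chord_tangent a b (val p) (val q)).1].
Proof.
case: p q => -[x1 y1] /= /eqP hp [[x2 y2] /= /eqP hq] n2.
rewrite /cubic !hornerE /chord_tangent /slope /= in hp hq *.
have [ex|nx] := eqVneq x1 x2 => /= ny; apply/eqP.
  rewrite -ex in hq *.
  have /eqP: (y1 - y2) * (y1 + y2) = 0 by rewrite -subr_sqr hp hq subrr.
  rewrite mulf_eq0 [y1 + y2 == 0]addr_eq0 (negPf ny) orbF subr_eq0 => /eqP ey.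
  have y0 : y1 != 0.
    by apply: contraNneq ny => y10; rewrite -ey y10 oppr0.
  have -> : c = y1 ^+ 2 - (x1 ^+ 3 + a * x1 ^+ 2 + b * x1) by rewrite hp; ring.
  by field; rewrite n2 y0.
have nx' : x2 - x1 != 0 by rewrite subr_eq0 eq_sym.
set l := (y2 - y1) / (x2 - x1).
have hl : y2 = y1 + l * (x2 - x1) by rewrite /l divfK // addrC subrK.
have e : l * (y1 + y2) = x2 ^+ 2 + x1 * x2 + x1 ^+ 2 + a * (x1 + x2) + b.
  apply: (mulIf nx').
  have -> : l * (y1 + y2) * (x2 - x1) = y2 ^+ 2 - y1 ^+ 2 by rewrite hl; ring.
  by rewrite hp hq; ring.
have -> : c = y1 ^+ 2 - (x1 ^+ 3 + a * x1 ^+ 2 + b * x1) by rewrite hp; ring.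
have -> : b = l * (y1 + y2) - (x2 ^+ 2 + x1 * x2 + x1 ^+ 2 + a * (x1 + x2)).
  by rewrite e; ring.
by rewrite hl; ring.
Qed.

(* insub checks membership in the curve; by chord_tangent_on_curve this check
   always succeeds here (for char K != 2). *)
Definition addE (K : fieldType) (a b c : K) (P Q : point a b c) : point a b c :=
  match P, Q with
  | None, _ => Q
  | _, None => P
  | Some p, Some q =>
      if ((val p).1 == (val q).1) && ((val p).2 == - (val q).2) then None
      else (insub (chord_tangent a b (val p) (val q)) : option (affpoint a b c))
  end.

Definition mulE (K : fieldType) (a b c : K) (n : nat) (P : point a b c) :
    point a b c :=
  iter n (addE P) None.

Definition has_order (K : fieldType) (a b c : K) (n : nat) (P : point a b c) :
    Prop :=
  [/\ (0 < n)%N, mulE n P = None &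
      forall m : nat, (0 < m < n)%N -> mulE m P <> None].

(* The local ring at p of the affine plane, inside the field K(x,y) *)

Definition regular_at (K : fieldType) (p : K * K)
    (phi : {fraction {poly {poly K}}}) : Prop :=
  exists A B : {poly {poly K}},
    B.[p.2%:P].[p.1] <> 0 /\ phi = tofrac A / tofrac B.

Definition local_ideal (K : fieldType) (p : K * K)
    (gens : seq {poly {poly K}}) (phi : {fraction {poly {poly K}}}) : Prop :=
  exists al : 'I_(size gens) -> {fraction {poly {poly K}}},
    (forall i, regular_at p (al i)) /\
    phi = \sum_(i < size gens) al i * tofrac (gens`_i).

Definition maxideal_pow_gens (K : fieldType) (p : K * K) (k : nat) :
    seq {poly {poly K}} :=
  [seq ('X - p.1%:P)%:P ^+ i * ('X - p.2%:P%:P) ^+ (k - i) | i <- iota 0 k.+1].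

(* For p a smooth point of F = 0: m is the largest k such that h belongs to the
   k-th power of the maximal ideal of the local ring of the curve F = 0 at p.
   There is no such m when h vanishes on the component of the curve at p. *)
Definition ord_on (K : fieldType) (F : {poly {poly K}}) (p : K * K)
    (h : {poly {poly K}}) (m : nat) : Prop :=
  forall k : nat,
    local_ideal p (F :: maxideal_pow_gens p k) (tofrac h) <-> (k <= m)%N.

(* dim_K O_p / (F, G) = m, through a basis e of the quotient *)
Definition intersection_mult (K : fieldType) (p : K * K)
    (F G : {poly {poly K}}) (m : nat) : Prop :=
  exists e : 'I_m -> {fraction {poly {poly K}}},
    (forall i, regular_at p (e i)) /\
    forall phi, regular_at p phi ->
      exists! v : 'rV[K]_m,
        local_ideal p [:: F; G]
          (phi - \sum_(i < m) tofrac ((v 0 i)%:P%:P) * e i).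

(* An affine chart of the projective plane around P: (X/Z, Y/Z) for affine P,
   and (X/Y, Z/Y) for O. *)

Definition chart (K : fieldType) (a b c : K) (P : point a b c)
    (G : {mpoly K[3]}) : {poly {poly K}} :=
  let s : seq {poly {poly K}} :=
    if P is Some _ then [:: 'X%:P; 'X; 1] else [:: 'X%:P; 1; 'X] in
  mmap (fun k : K => k%:P%:P) (fun i : 'I_3 => s`_i) G.

Definition chart_coord (K : fieldType) (a b c : K) (P : point a b c) : K * K :=
  if P is Some p then val p else (0, 0).

Definition divisor (K : fieldType) (a b c : K) := {freeg (point a b c)}.

(* The principal divisor of the rational function A/B on E, for forms A and B of
   the same degree *)
Definition is_principal_divisor (K : fieldType) (a b c : K)
    (A B : {mpoly K[3]}) (D : divisor a b c) : Prop :=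
  forall P : point a b c, exists i j : nat,
    [/\ ord_on (chart P (weierstrass a b c)) (chart_coord P) (chart P A) i,
        ord_on (chart P (weierstrass a b c)) (chart_coord P) (chart P B) j
      & coeff P D = i%:Z - j%:Z].

Definition has_divisor (K : fieldType) (a b c : K) (g : {poly {poly K}})
    (D : divisor a b c) : Prop :=
  is_principal_divisor (homogenize g) (pZ K ^+ tdeg g) D.

(* The curve G = 0 does not contain E and cuts out the divisor D on E. *)
Definition cuts_out (K : fieldType) (a b c : K) (G : {mpoly K[3]})
    (D : divisor a b c) : Prop :=
  (~ exists Q : {mpoly K[3]}, G = Q * weierstrass a b c) /\
  forall P : point a b c, exists m : nat,
    intersection_mult (chart_coord P) (chart P (weierstrass a b c)) (chart P G) m
    /\ coeff P D = m%:Z.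

Definition weak_contact_curve (K : fieldType) (a b c : K) (n : nat)
    (G : {mpoly K[3]}) : Prop :=
  is_plane_curve G /\
  exists (Ps : seq (point a b c)) (s : nat),
    cuts_out G ((\sum_(P <- Ps) << P >>) *+ n + << s%:Z *g (None : point a b c) >>).

(* Main.v *)
(* At a smooth point the local ring of E is a discrete valuation ring. The
orders of b and xi are read off the given divisors, and b^n xi = c0 + c1 y on
E, so the order of c0 + c1 y is known at every affine point of E. At the zeros
of x - x_d, namely P_d and its image under iota, it is at least n times the
order of x - x_d, which forces (x - x_d)^n to divide c0 and c1. The quotient g
then has order n mult_P(d) at each affine P. The identity
b^n xi = q (y^2 - f) + g (x - x_d)^n, rewritten in the coordinates (X/Y, Z/Y),
gives the order of g at O, where Z vanishes to order 3. Finally, expansion in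
powers of a uniformizer shows that the order of a function at P is the
dimension of the quotient of the local ring by the ideal it generates. *)

Require Import Defs.
From HB Require Import structures.
From mathcomp Require Import all_boot all_order all_algebra.
From mathcomp Require Import complex reals.
From mathcomp Require Import freeg mpoly.
From mathcomp Require Import ring fraction zify.

Import GRing.Theory.
Local Open Scope ring_scope.

Set Implicit Arguments.
Unset Strict Implicit.
Unset Printing Implicit Defensive.

(** * Orders in the local ring of a plane curve *)

Definition eval2 {K : fieldType} (p : K * K) (h : {poly {poly K}}) : K :=
  h.[p.2%:P].[p.1].

Lemma eval2C {K : fieldType} (p : K * K) (q : {poly K}) :
  eval2 p q%:P = q.[p.1].
Proof. by rewrite /eval2 hornerC. Qed.

Lemma eval2X {K : fieldType} (p : K * K) : eval2 p 'X = p.2.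
Proof. by rewrite /eval2 hornerX hornerC. Qed.

Lemma eval2D {K : fieldType} (p : K * K) : {morph eval2 p : g h / g + h}.
Proof. by move=> g h; rewrite /eval2 !hornerD. Qed.

Lemma eval2N {K : fieldType} (p : K * K) : {morph eval2 p : g / - g}.
Proof. by move=> g; rewrite /eval2 !hornerN. Qed.

Lemma eval2M {K : fieldType} (p : K * K) : {morph eval2 p : g h / g * h}.
Proof. by move=> g h; rewrite /eval2 !hornerM. Qed.

Lemma eval2_exp {K : fieldType} (p : K * K) (n : nat) :
  {morph eval2 p : g / g ^+ n}.
Proof. by move=> g; rewrite /eval2 !horner_exp. Qed.

Lemma eval2_0 {K : fieldType} (p : K * K) : eval2 p 0 = 0.
Proof. by rewrite /eval2 !horner0. Qed.

Lemma eval2_1 {K : fieldType} (p : K * K) : eval2 p 1 = 1.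
Proof. by rewrite /eval2 !hornerC. Qed.

Definition eval2E {K : fieldType} (p : K * K) :=
  (eval2D p, eval2N p, eval2_exp p, eval2M p, eval2X p, eval2_0 p, eval2_1 p,
   eval2C p).

(** The two coordinates generate the maximal ideal at [p]: [y - p.2] divides [h - h(x, p.2)], and
    [x - p.1] divides [h(x, p.2)]. *)
Lemma eval2_eq0_decomp {K : fieldType} (p : K * K) (h : {poly {poly K}}) :
  eval2 p h = 0 ->
  exists u v, h = ('X - p.1%:P)%:P * u + ('X - p.2%:P%:P) * v.
Proof.
move=> h0.
have /factor_theorem[q eq] : root (h - (h.[p.2%:P])%:P) p.2%:P.
  by rewrite /root !hornerE subrr.
have /factor_theorem[r er] : root h.[p.2%:P] p.1 by apply/eqP.
exists r%:P, q; rewrite -[LHS](subrK (h.[p.2%:P])%:P) eq er polyCM.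
by rewrite addrC; congr (_ + _); rewrite mulrC.
Qed.

Section LocalRing.

Variables (K : fieldType) (F t : {poly {poly K}}) (p : K * K).

(* In the local ring at p of the curve F = 0, h lies in (t^k), resp. h is t^k
   times a unit; B clears the denominators. *)
Definition val_ge (h : {poly {poly K}}) (k : nat) : Prop :=
  exists A B C, eval2 p B <> 0 /\ h * B = t ^+ k * A + F * C.

Definition val_at (h : {poly {poly K}}) (k : nat) : Prop :=
  exists A B C, [/\ eval2 p A <> 0, eval2 p B <> 0
                 & h * B = t ^+ k * A + F * C].

(* t generates the maximal ideal of the local ring of F = 0 at p, and is not a
   zero divisor modulo F. It is one of the two coordinates, so that t^k is among
   the generators maxideal_pow_gens p k. *)
Record uniformizer : Prop := Uniformizer {
  unif_on : eval2 p F = 0;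
  unif_coord : t = ('X - p.1%:P)%:P \/ t = 'X - p.2%:P%:P;
  unif_gen : forall h, eval2 p h = 0 -> val_ge h 1;
  unif_reg : forall U A, t * U = F * A -> exists A', U = F * A' }.

Lemma eval2_neq0M (g h : {poly {poly K}}) :
  eval2 p g <> 0 -> eval2 p h <> 0 -> eval2 p (g * h) <> 0.
Proof.
by move=> /eqP g0 /eqP h0; apply/eqP; rewrite eval2M mulf_neq0.
Qed.

Lemma val_ge_self (k : nat) : val_ge (t ^+ k) k.
Proof.
exists 1, 1, 0; rewrite eval2_1; split; first by apply/eqP/oner_neq0.
by ring.
Qed.

Lemma val_at_ge h k : val_at h k -> val_ge h k.
Proof. by case=> A [B [C [_ B0 e]]]; exists A, B, C. Qed.

Lemma val_geD g h k : val_ge g k -> val_ge h k -> val_ge (g + h) k.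
Proof.
move=> [A [B [C [B0 e]]]] [A' [B' [C' [B'0 e']]]].
exists (A * B' + A' * B), (B * B'), (C * B' + C' * B).
split; first exact: eval2_neq0M.
have -> : (g + h) * (B * B') = (g * B) * B' + (h * B') * B by ring.
by rewrite e e'; ring.
Qed.

Lemma val_geM g h k l : val_ge g k -> val_ge h l -> val_ge (g * h) (k + l).
Proof.
move=> [A [B [C [B0 e]]]] [A' [B' [C' [B'0 e']]]].
exists (A * A'), (B * B'),
  (C * (t ^+ l * A' + F * C') + t ^+ k * A * C').
split; first exact: eval2_neq0M.
have -> : (g * h) * (B * B') = (g * B) * (h * B') by ring.
by rewrite e e' exprD; ring.
Qed.

Lemma val_geMr g h k : val_ge g k -> val_ge (g * h) k.
Proof.
move=> gk; rewrite -[k]addn0; apply: val_geM => //.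
exists h, 1, 0; rewrite eval2_1; split; first by apply/eqP/oner_neq0.
by ring.
Qed.

Lemma val_geX g k n : val_ge g k -> val_ge (g ^+ n) (n * k).
Proof.
move=> gk; elim: n => [|n IH]; first by rewrite expr0; apply: (val_ge_self 0).
by rewrite exprS mulSn; apply: val_geM.
Qed.

Lemma val_ge_le h k l : (l <= k)%N -> val_ge h k -> val_ge h l.
Proof.
move=> lk [A [B [C [B0 e]]]]; exists (t ^+ (k - l) * A), B, C.
by split=> //; rewrite e mulrA -exprD subnKC.
Qed.

Lemma val_atM g h k l : val_at g k -> val_at h l -> val_at (g * h) (k + l).
Proof.
move=> [A [B [C [A0 B0 e]]]] [A' [B' [C' [A'0 B'0 e']]]].
exists (A * A'), (B * B'),
  (C * (t ^+ l * A' + F * C') + t ^+ k * A * C').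
split; [exact: eval2_neq0M | exact: eval2_neq0M | ].
have -> : (g * h) * (B * B') = (g * B) * (h * B') by ring.
by rewrite e e' exprD; ring.
Qed.

Lemma val_at_unit h : eval2 p h <> 0 -> val_at h 0.
Proof.
move=> h0; exists h, 1, 0; rewrite eval2_1; split=> //.
  by apply/eqP/oner_neq0.
by ring.
Qed.

Lemma val_atX g k n : val_at g k -> val_at (g ^+ n) (n * k).
Proof.
move=> gk; elim: n => [|n IH].
  by rewrite expr0; apply: val_at_unit; rewrite eval2_1; apply/eqP/oner_neq0.
by rewrite exprS mulSn; apply: val_atM.
Qed.

Lemma val_at_self k : val_at (t ^+ k) k.
Proof.
exists 1, 1, 0; rewrite eval2_1; split; try by apply/eqP/oner_neq0.
by ring.
Qed.

Lemma val_at_congr g h q k : g = h + q * F -> val_at g k -> val_at h k.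
Proof.
move=> -> [A [B [C [A0 B0 e]]]]; exists A, B, (C - q * B); split=> //.
by rewrite mulrBr addrA -e; ring.
Qed.

Hypothesis unif : uniformizer.

Lemma unif_regX k U A : t ^+ k * U = F * A -> exists A', U = F * A'.
Proof.
elim: k U A => [|k IH] U A; first by rewrite expr0 mul1r; exists A.
by rewrite exprS -mulrA => /(unif_reg unif) [A'] /IH.
Qed.

Lemma eval2_unif : eval2 p t = 0.
Proof. by case: (unif_coord unif) => ->; rewrite !eval2E ?hornerE subrr. Qed.

Lemma eval2_multiple A : eval2 p (F * A) = 0.
Proof. by rewrite eval2M (unif_on unif) mul0r. Qed.

Lemma val_ge_eval2 h k : (0 < k)%N -> val_ge h k -> eval2 p h = 0.
Proof.
move=> k0 [A [B [C [/eqP B0 e]]]].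
have := congr1 (eval2 p) e.
rewrite eval2D eval2_multiple addr0 !eval2M eval2_exp eval2_unif expr0n.
by rewrite gtn_eqF // mul0r => /eqP; rewrite mulf_eq0 (negPf B0) orbF => /eqP.
Qed.

(** Cancelling [t ^+ k] turns the unit numerator [A'] of [h] into a relation [A' * B = F * A''],
    which is then evaluated at [p]. With [B = 1] it shows that a function of finite order is not a
    multiple of [F]. *)
Lemma val_at_not_multiple h k B A :
  val_at h k -> h * B = F * A -> eval2 p B = 0.
Proof.
move=> [A' [B' [C' [/eqP A'0 B'0 e]]]] hB.
have /unif_regX [A'' e''] : t ^+ k * (A' * B) = F * (A * B' - C' * B).
  have -> : t ^+ k * (A' * B) = (t ^+ k * A' + F * C') * B - F * C' * B by ring.
  rewrite -e; have -> : h * B' * B = (h * B) * B' by ring.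
  by rewrite hB; ring.
have := eval2_multiple A''; rewrite -e'' eval2M => /eqP.
by rewrite mulf_eq0 (negPf A'0) => /eqP.
Qed.

(** If [k < l], comparing the two presentations of [h] and cancelling [t ^+ k] leaves a unit equal,
    modulo [F], to a multiple of [t ^+ (l - k)], which vanishes at [p]. *)
Lemma val_at_ge_le h k l : val_at h k -> val_ge h l -> (l <= k)%N.
Proof.
move=> hk [A [B [C [B0 e]]]]; rewrite leqNgt; apply/negP => kl.
case: hk => A' [B' [C' [/eqP A'0 /eqP B'0 e']]].
have /unif_regX [A'' e''] :
    t ^+ k * (A' * B - t ^+ (l - k) * A * B') = F * (C * B' - C' * B).
  rewrite mulrBr !mulrA -exprD subnKC 1?ltnW //.
  rewrite -[t ^+ k * A'](addrK (F * C')) -[t ^+ l * A](addrK (F * C)).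
  by rewrite -e -e'; ring.
have := eval2_multiple A''; rewrite -e'' eval2D eval2N !eval2M eval2_exp.
rewrite eval2_unif expr0n subn_eq0 leqNgt kl /= !mul0r subr0 => /eqP.
by rewrite mulf_eq0 (negPf A'0) (introF eqP B0).
Qed.

Lemma val_at_uniq h k l : val_at h k -> val_at h l -> k = l.
Proof.
move=> hk hl; apply/eqP; rewrite eqn_leq.
by rewrite (val_at_ge_le hk (val_at_ge hl))
           (val_at_ge_le hl (val_at_ge hk)).
Qed.

Lemma val_ge_div g h m l :
  val_ge (g * h) (m + l) -> val_at h l -> val_ge g m.
Proof.
move=> [A [B [C [B0 e]]]] [A' [B' [C' [A'0 B'0 e']]]].
have /unif_regX [A'' e''] :
    t ^+ l * (g * (B * A') - t ^+ m * (A * B')) = F * (C * B' - g * B * C').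
  have -> : t ^+ l * (g * (B * A') - t ^+ m * (A * B')) =
    g * B * (t ^+ l * A') - t ^+ (m + l) * A * B' by rewrite exprD; ring.
  rewrite -[t ^+ l * A'](addrK (F * C')) -[t ^+ (m + l) * A](addrK (F * C)).
  by rewrite -e -e'; ring.
exists (A * B'), (B * A'), A''; split; first exact: eval2_neq0M.
by rewrite -e'' addrC subrK.
Qed.

(** A numerator vanishing at [p] lies in the maximal ideal, so it supplies one more factor [t]. *)
Lemma val_ge_succ h k A B C : eval2 p B <> 0 ->
  h * B = t ^+ k * A + F * C -> eval2 p A = 0 -> val_ge h k.+1.
Proof.
move=> B0 e /(unif_gen unif) [A' [B' [C' [B'0 e']]]].
exists A', (B * B'), (C * B' + t ^+ k * C'); split; first exact: eval2_neq0M.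
rewrite mulrA e; have -> : (t ^+ k * A + F * C) * B' =
  t ^+ k * (A * B') + F * C * B' by ring.
by rewrite e' (exprS t k); ring.
Qed.

Lemma val_ge_at h k : val_ge h k -> ~ val_ge h k.+1 -> val_at h k.
Proof.
move=> [A [B [C [B0 e]]]] nh; exists A, B, C; split=> // A0.
exact/nh/(val_ge_succ B0 e A0).
Qed.

Lemma val_at_div g h m l :
  val_at (g * h) m -> val_at h l -> exists2 k, val_at g k & (m = k + l)%N.
Proof.
move=> ghm hl.
have lm : (l <= m)%N.
  apply: (val_at_ge_le ghm); rewrite mulrC; apply: val_geMr.
  exact: val_at_ge.
exists (m - l)%N; last by rewrite subnK.
apply: val_ge_at.
  by apply: val_ge_div hl; rewrite subnK //; apply: val_at_ge.
move=> /val_geM/(_ (val_at_ge hl))/(val_at_ge_le ghm).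
by rewrite addSn subnK // ltnn.
Qed.

End LocalRing.

(** * Orders and intersection multiplicities *)

Lemma lincomb_over (L : fieldType) (a c f g b : L) : b != 0 ->
  (a / b * f + c / b * g) * b = a * f + c * g.
Proof. by move=> b0; field. Qed.

Section LocalIdeal.

Variables (K : fieldType) (p : K * K).
Implicit Types (gens : seq {poly {poly K}}) (phi : {fraction {poly {poly K}}}).

Lemma tofrac_eval2_neq0 (B : {poly {poly K}}) :
  eval2 p B <> 0 -> tofrac B != 0.
Proof.
move=> B0; rewrite tofrac_eq0; apply: contra_notN B0 => /eqP ->.
exact: eval2_0.
Qed.

Lemma regular_at_frac (A B : {poly {poly K}}) :
  eval2 p B <> 0 -> regular_at p (tofrac A / tofrac B).
Proof. by exists A, B. Qed.

Lemma regular_at0 : regular_at p 0.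
Proof.
by exists 0, 1; rewrite tofrac0 mul0r; split=> //;
  rewrite -/(eval2 p 1) eval2_1; apply/eqP/oner_neq0.
Qed.

Lemma regular_atD phi psi :
  regular_at p phi -> regular_at p psi -> regular_at p (phi + psi).
Proof.
move=> [A [B [B0 ->]]] [A' [B' [B'0 ->]]].
rewrite -/(eval2 p _) in B0 B'0.
exists (A * B' + A' * B), (B * B'); split; first exact: eval2_neq0M.
rewrite (addf_div _ _ (tofrac_eval2_neq0 B0) (tofrac_eval2_neq0 B'0)).
by rewrite tofracD !tofracM.
Qed.

Lemma local_idealD gens phi psi :
  local_ideal p gens phi -> local_ideal p gens psi ->
  local_ideal p gens (phi + psi).
Proof.
move=> [al [al_reg ->]] [be [be_reg ->]]; exists (fun i => al i + be i).
split=> [i|]; first exact: regular_atD.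
by rewrite -big_split; apply: eq_bigr => i _; rewrite mulrDl.
Qed.

Lemma local_ideal_gen gens phi j : (j < size gens)%N -> regular_at p phi ->
  local_ideal p gens (phi * tofrac gens`_j).
Proof.
move=> jlt phi_reg; exists (fun i => if i == Ordinal jlt then phi else 0).
split=> [i|]; first by case: ifP => _ //; apply: regular_at0.
rewrite (bigD1 (Ordinal jlt)) //= eqxx big1 ?addr0 // => i /negPf ->.
by rewrite mul0r.
Qed.

End LocalIdeal.

(** * Powers of the maximal ideal, and the quotient of the local ring by a function *)

Section LocalQuotient.

Variables (K : fieldType) (F t : {poly {poly K}}) (p : K * K).

(** Local ideals consist of elements of K(x,y), so the bound [val_ge] is extended from polynomials
    to fractions. *)
Definition frac_val_ge (phi : {fraction {poly {poly K}}}) (k : nat) : Prop :=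
  exists A B C, eval2 p B <> 0 /\ phi * tofrac B = tofrac (t ^+ k * A + F * C).

Lemma frac_val_ge_poly h k : frac_val_ge (tofrac h) k <-> val_ge F t p h k.
Proof.
split=> -[A [B [C [B0 e]]]]; exists A, B, C; split=> //.
  by apply/eqP; rewrite -tofrac_eq tofracM; apply/eqP.
by rewrite -tofracM e.
Qed.

Lemma frac_val_geD phi psi k :
  frac_val_ge phi k -> frac_val_ge psi k -> frac_val_ge (phi + psi) k.
Proof.
move=> [A [B [C [B0 e]]]] [A' [B' [C' [B'0 e']]]].
exists (A * B' + A' * B), (B * B'), (C * B' + C' * B).
split; first exact: eval2_neq0M.
have -> : (phi + psi) * tofrac (B * B') =
  (phi * tofrac B) * tofrac B' + (psi * tofrac B') * tofrac B.
  by rewrite tofracM; ring.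
by rewrite e e' -!tofracM -tofracD; congr tofrac; ring.
Qed.

Lemma frac_val_geMr phi psi k :
  regular_at p psi -> frac_val_ge phi k -> frac_val_ge (psi * phi) k.
Proof.
move=> [U [V [V0 ->]]] [A [B [C [B0 e]]]]; rewrite -/(eval2 p V) in V0.
exists (A * U), (V * B), (C * U); split; first exact: eval2_neq0M.
have -> : tofrac U / tofrac V * phi * tofrac (V * B) =
    tofrac U * (phi * tofrac B) * (tofrac V / tofrac V).
  by rewrite tofracM; ring.
rewrite divff ?(tofrac_eval2_neq0 V0) // mulr1 e -tofracM; congr tofrac; ring.
Qed.

Lemma val_ge_multiple q k : val_ge F t p (F * q) k.
Proof.
exists 0, 1, q; rewrite eval2_1; split; first by apply/eqP/oner_neq0.
by ring.
Qed.

Lemma val_ge_curve k : val_ge F t p F k.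
Proof. by have := val_ge_multiple 1 k; rewrite mulr1. Qed.

Lemma local_ideal_val_ge gens phi k :
  (forall g, g \in gens -> val_ge F t p g k) ->
  local_ideal p gens phi -> frac_val_ge phi k.
Proof.
move=> gens_k [al [al_reg ->]].
apply: (big_ind (frac_val_ge ^~ k)) => [|*|i _].
- by apply/frac_val_ge_poly; rewrite -[0](mulr0 F); apply: val_ge_multiple.
- exact: frac_val_geD.
- apply: frac_val_geMr => //; apply/frac_val_ge_poly/gens_k.
  by rewrite mem_nth.
Qed.

Hypothesis unif : uniformizer F t p.

Lemma maxideal_pow_gens_val_ge k g :
  g \in maxideal_pow_gens p k -> val_ge F t p g k.
Proof.
move=> /mapP [j j_k ->].
have {j_k} jk : (j <= k)%N by move: j_k; rewrite mem_iota.
rewrite -[X in val_ge _ _ _ _ X](subnKC jk); apply: val_geM.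
  rewrite -{2}[j]muln1; apply: val_geX; apply: (unif_gen unif).
  by rewrite !eval2E !hornerE subrr.
rewrite -{2}[(k - j)%N]muln1; apply: val_geX; apply: (unif_gen unif).
by rewrite !eval2E !hornerE subrr.
Qed.

Lemma unifX_in_maxideal_pow_gens k :
  exists2 j, (j < size (maxideal_pow_gens p k))%N
           & (maxideal_pow_gens p k)`_j = t ^+ k.
Proof.
rewrite size_map size_iota.
(* The generators are ordered by the exponent of [x - p.1]: its pure power comes last, that of
   [y - p.2] first. *)
case: (unif_coord unif) => ->; [exists k | exists 0%N] => //;
  rewrite (nth_map 0%N) ?size_iota // nth_iota // add0n.
- by rewrite subnn mulr1.
- by rewrite subn0 mul1r.
Qed.

Lemma val_ge_local_ideal h k : val_ge F t p h k ->
  local_ideal p (F :: maxideal_pow_gens p k) (tofrac h).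
Proof.
move=> [A [B [C [B0 e]]]].
have [j jlt jE] := unifX_in_maxideal_pow_gens k.
have -> : tofrac h = tofrac A / tofrac B * tofrac (t ^+ k)
                     + tofrac C / tofrac B * tofrac F.
  have B0' := tofrac_eval2_neq0 B0; apply: (mulIf B0').
  rewrite -[LHS]tofracM e tofracD !tofracM.
  by rewrite (lincomb_over _ _ _ _ B0') mulrC [tofrac F * _]mulrC.
rewrite -jE; apply: local_idealD.
  exact/(@local_ideal_gen _ p (F :: _) _ j.+1)/regular_at_frac.
exact/(@local_ideal_gen _ p (F :: _) _ 0%N)/regular_at_frac.
Qed.

(** Modulo [F] the [k]-th power of the maximal ideal is generated by [t ^+ k], so membership for [m]
    and its failure for [m.+1] force a unit numerator. *)
Lemma ord_on_val_at h m : ord_on F p h m -> val_at F t p h m.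
Proof.
move=> h_ord; apply: (val_ge_at unif) => [|/val_ge_local_ideal].
  have /h_ord h_m := leqnn m; apply/frac_val_ge_poly.
  apply: local_ideal_val_ge h_m => g; rewrite inE => /predU1P[->|].
    exact: val_ge_curve.
  exact: maxideal_pow_gens_val_ge.
by move=> /h_ord; rewrite ltnn.
Qed.

Lemma unif_expansion (U V : {poly {poly K}}) (m : nat) : eval2 p V <> 0 ->
  exists v : nat -> K,
    val_ge F t p (U - V * \sum_(i < m) (v i)%:P%:P * t ^+ i) m.
Proof.
move=> V0; elim: m => [|m [v [A [B [C [B0 e]]]]]].
  exists (fun=> 0), U, 1, 0; rewrite eval2_1; split.
    by apply/eqP/oner_neq0.
  by rewrite big_ord0; ring.
(* The next coefficient is the one making the new numerator [A - w V B] vanish at [p]. *)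
pose w := eval2 p A / (eval2 p V * eval2 p B).
exists (fun i => if i == m then w else v i).
rewrite big_ord_recr /= eqxx.
under eq_bigr => i _ do rewrite ltn_eqF //.
apply: (@val_ge_succ _ F t p unif _ m (A - w%:P%:P * V * B) B C) => //.
  rewrite mulrDr opprD addrA mulrBl e; ring.
rewrite !eval2E hornerC /w; apply/eqP; rewrite subr_eq0 -mulrA divfK //.
by rewrite mulf_neq0 //; apply/eqP.
Qed.

(** The constant term is the value at [p], hence zero; dividing by [t] shifts the coefficients and
    lowers the bound by one. *)
Lemma unif_expansion_uniq (w : nat -> K) (m : nat) :
  val_ge F t p (\sum_(i < m) (w i)%:P%:P * t ^+ i) m ->
  forall i, (i < m)%N -> w i = 0.
Proof.
elim: m w => [|m IH] w // wm.
have e : \sum_(i < m.+1) (w i)%:P%:P * t ^+ i =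
    (w 0%N)%:P%:P + (\sum_(i < m) (w i.+1)%:P%:P * t ^+ i) * t.
  rewrite big_ord_recl expr0 mulr1; congr (_ + _); rewrite mulr_suml.
  by apply: eq_bigr => i _; rewrite -mulrA -exprSr.
have w0 : w 0%N = 0.
  have := val_ge_eval2 unif (ltn0Sn m) wm.
  by rewrite e !eval2E (eval2_unif unif) mulr0 addr0 hornerC.
move: wm; rewrite e w0 !polyC0 add0r -addn1 => wm [_|i]; first exact: w0.
rewrite addn1 ltnS => im; apply: (IH (fun i => w i.+1)) => //.
exact: (val_ge_div unif wm (val_at_self F t p 1)).
Qed.

(** As [G] is [t ^+ m] times a unit modulo [F], the powers of [t] below [m] form a basis of the
    quotient by [(F, G)]: expansions in [t] give spanning, their uniqueness gives independence. *)
Lemma val_at_intersection_mult G m :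
  val_at F t p G m -> intersection_mult p F G m.
Proof.
move=> G_m; exists (fun i => tofrac (t ^+ i)); split=> [i|phi].
  exists (t ^+ i), 1; rewrite tofrac1 divr1; split=> //.
  by rewrite -/(eval2 p 1) eval2_1; apply/eqP/oner_neq0.
have sumE (v : 'I_m -> K) :
    \sum_(i < m) tofrac (v i)%:P%:P * tofrac (t ^+ i) =
    tofrac (\sum_(i < m) (v i)%:P%:P * t ^+ i).
  rewrite (big_morph _ (@tofracD _) (tofrac0 _)).
  by apply: eq_bigr => i _; rewrite tofracM.
move=> [U [V [V0 ->]]]; rewrite -/(eval2 p V) in V0.
have [v v_m] := unif_expansion U m V0.
have V0' := tofrac_eval2_neq0 V0.
exists (\row_i v i); split.
  have -> : \sum_(i < m) tofrac ((\row_i0 v i0) 0 i)%:P%:P * tofrac (t ^+ i)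
      = tofrac (\sum_(i < m) (v i)%:P%:P * t ^+ i).
    by rewrite -sumE; apply: eq_bigr => i _; rewrite mxE.
  case: G_m => A [B [C [A0 B0 eG]]]; case: v_m => A' [B' [C' [B'0 e]]].
  set S := \sum_(i < m) _ in e *.
  have D0 : eval2 p (V * (A * B')) <> 0 by do 2?apply: eval2_neq0M.
  (* These coefficients come from eliminating [t ^+ m] between [(U - V S) B' = t^m A' + F C'] and
     [G B = t^m A + F C]. *)
  have -> : tofrac U / tofrac V - tofrac S =
      tofrac (C' * A - A' * C) / tofrac (V * (A * B')) * tofrac F
      + tofrac (B * A') / tofrac (V * (A * B')) * tofrac G.
    apply: (mulIf (tofrac_eval2_neq0 D0)).
    rewrite (lincomb_over _ _ _ _ (tofrac_eval2_neq0 D0)).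
    have -> : (tofrac U / tofrac V - tofrac S) * tofrac (V * (A * B')) =
        tofrac ((U - V * S) * B' * A).
      rewrite !tofracM tofracB tofracM !mulrA.
      by rewrite [(_ / _ - _) * _]mulrBl (divfK V0') [tofrac S * _]mulrC mulrAC.
    rewrite e -!tofracM -tofracD; congr tofrac.
    have -> : B * A' * G = (G * B) * A' by ring.
    by rewrite eG; ring.
  apply: local_idealD.
    exact/(@local_ideal_gen _ p [:: F; G] _ 0%N)/regular_at_frac.
  exact/(@local_ideal_gen _ p [:: F; G] _ 1%N)/regular_at_frac.
move=> v' v'_in.
have v'_m : frac_val_ge (tofrac U / tofrac V -
    \sum_(i < m) tofrac (v' 0 i)%:P%:P * tofrac (t ^+ i)) m.
  apply: local_ideal_val_ge v'_in => g; rewrite !inE => /predU1P[->|/eqP->].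
    exact: val_ge_curve.
  exact: val_at_ge.
have {}v_m : frac_val_ge (- (tofrac U / tofrac V) +
    tofrac (\sum_(i < m) (v i)%:P%:P * t ^+ i)) m.
  have -> : - (tofrac U / tofrac V) + tofrac (\sum_(i < m) (v i)%:P%:P * t ^+ i)
     = (tofrac (-1) / tofrac V) *
       tofrac (U - V * \sum_(i < m) (v i)%:P%:P * t ^+ i).
    rewrite tofracB tofracM tofracN tofrac1 mulN1r mulrBr !mulNr opprK.
    by rewrite mulrA (mulVf V0') mul1r [_^-1 * _]mulrC.
  by apply: frac_val_geMr; [apply: regular_at_frac | apply/frac_val_ge_poly].
have := frac_val_geD v_m v'_m.
rewrite sumE addrACA addNr add0r -tofracB => /frac_val_ge_poly.
rewrite -sumrB => vv'_m.
(* The row [v'] is extended to all of [nat]; the default 0 is reached only for indices outside the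
   sum. *)
pose w i := v i - (if insub i is Some j then v' 0 j else 0).
have : val_ge F t p (\sum_(i < m) (w i)%:P%:P * t ^+ i) m.
  rewrite (eq_bigr (fun i : 'I_m => (v i)%:P%:P * t ^+ i
                                     - (v' 0 i)%:P%:P * t ^+ i)) // => i _.
  by rewrite /w valK !polyCB mulrBl.
move=> /unif_expansion_uniq w0; apply/rowP => i.
have := w0 i (ltn_ord i); rewrite /w valK mxE => /eqP.
by rewrite subr_eq0 => /eqP.
Qed.

End LocalQuotient.

(** * Homogenization and charts *)

Lemma dehomogenize_monomial (L : fieldType) (k x z : L) (e i j : nat) :
  z != 0 -> k * (x ^+ j * z ^+ e) =
  z ^+ (e + (i + j)) * (k * ((x / z) ^+ j * z^-1 ^+ i)).
Proof.
by move=> z0; rewrite !exprD expr_div_n exprVn; field; rewrite !expf_neq0.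
Qed.

Section Charts.

Variables (K : fieldType) (a b c : K).
Implicit Types (P : point a b c) (G H : {mpoly K[3]}) (g : {poly {poly K}}).

Lemma tdeg_ge g i j : g`_i`_j != 0 -> (i + j <= tdeg g)%N.
Proof.
move=> gij.
have ilt : (i < size g)%N.
  by rewrite ltnNge; apply: contraNN gij => /(nth_default 0) ->; rewrite coef0.
have jlt : (j < size (g`_i)%R)%N.
  by rewrite ltnNge; apply: contraNN gij => /(nth_default 0) ->.
rewrite /tdeg; apply: leq_trans (leq_bigmax (Ordinal ilt)).
exact: (leq_bigmax_cond (Ordinal jlt)).
Qed.

Definition constant_poly2 : {rmorphism K -> {poly {poly K}}} := polyC \o polyC.

(** The map [chart P] with its ring morphism structure, from which its algebraic rules follow. *)
Definition chart_morph P : {rmorphism {mpoly K[3]} -> {poly {poly K}}} :=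
  mmap constant_poly2
    (fun i : 'I_3 =>
       (if P is Some _ then [:: 'X%:P; 'X; 1] else [:: 'X%:P; 1; 'X])`_i).

Lemma chartM P : {morph chart P : G H / G * H}.
Proof. exact: (rmorphM (chart_morph P)). Qed.

Lemma chartD P : {morph chart P : G H / G + H}.
Proof. exact: (rmorphD (chart_morph P)). Qed.

Lemma chartN P : {morph chart P : G / - G}.
Proof. exact: (rmorphN (chart_morph P)). Qed.

Lemma chart0 P : chart P 0 = 0.
Proof. exact: (rmorph0 (chart_morph P)). Qed.

Lemma chartXn P n : {morph chart P : G / G ^+ n}.
Proof. exact: (rmorphXn (chart_morph P)). Qed.

Lemma chartZ P (k : K) G : chart P (k *: G) = k%:P%:P * chart P G.
Proof. exact: (mmapZ _ constant_poly2). Qed.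

Lemma chart_var P (k : 'I_3) : chart P 'X_k =
  (if P is Some _ then [:: 'X%:P; 'X; 1] else [:: 'X%:P; 1; 'X])`_k.
Proof.
transitivity (mmap1 (fun i : 'I_3 =>
  (if P is Some _ then [:: 'X%:P; 'X; 1] else [:: 'X%:P; 1; 'X])`_i
    : {poly {poly K}}) U_(k)%MM).
  exact: (mmapX _ constant_poly2).
exact: mmap1U.
Qed.

Lemma chart_pX P : chart P (pX K) = 'X%:P.
Proof. by rewrite /pX chart_var inordK //; case: P. Qed.

Lemma chart_pY P : chart P (pY K) = if P is Some _ then 'X else 1.
Proof. by rewrite /pY chart_var inordK //; case: P. Qed.

Lemma chart_pZ P : chart P (pZ K) = if P is Some _ then 1 else 'X.
Proof. by rewrite /pZ chart_var inordK //; case: P. Qed.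

Definition chartE :=
  (chartM, chartD, chartN, chartXn, chartZ, chart_pX, chart_pY, chart_pZ).

Lemma chart_homogenize P g : chart P (homogenize g) =
  \sum_(i < size g) \sum_(j < size g`_i) (g`_i`_j)%:P%:P *
    chart P (pX K ^+ j * pY K ^+ i * pZ K ^+ (tdeg g - (i + j))).
Proof.
rewrite /homogenize (big_morph _ (@chartD P) (chart0 P)).
apply: eq_bigr => i _; rewrite (big_morph _ (@chartD P) (chart0 P)).
by apply: eq_bigr => j _; rewrite chartZ.
Qed.

Lemma poly2_sum g : g = \sum_(i < size g) \sum_(j < size g`_i)
    (g`_i`_j)%:P%:P * ('X%:P ^+ j * 'X ^+ i).
Proof.
rewrite -[LHS]coefK poly_def; apply: eq_bigr => i _.
rewrite -mul_polyC -[in LHS](coefK (g`_i)) poly_def rmorph_sum mulr_suml.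
by apply: eq_bigr => j _; rewrite -mul_polyC /= polyCM rmorphXn -mulrA.
Qed.

Lemma chart_affine_homogenize (p : affpoint a b c) g :
  chart (Some p) (homogenize g) = g.
Proof.
rewrite chart_homogenize [RHS]poly2_sum; apply: eq_bigr => i _.
by apply: eq_bigr => j _; rewrite !chartE expr1n mulr1.
Qed.

Local Notation L := {fraction {poly {poly K}}}.

Definition frac_const : {rmorphism K -> L} := @tofrac _ \o constant_poly2.

(* Passing from the affine coordinates (X/Z, Y/Z) to the coordinates
   (X/Y, Z/Y) at O: x becomes x/z and y becomes 1/z. *)
Definition at_infinity_x : {rmorphism {poly K} -> L} :=
  horner_morph (fun k => mulrC (tofrac ('X%:P) / tofrac 'X) (frac_const k)).

Definition at_infinity : {rmorphism {poly {poly K}} -> L} :=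
  horner_morph (fun q => mulrC (tofrac 'X)^-1 (at_infinity_x q)).

Lemma at_infinityC (k : K) : at_infinity k%:P%:P = tofrac k%:P%:P.
Proof. by rewrite /at_infinity /= horner_morphC /= horner_morphC. Qed.

Lemma at_infinityX : at_infinity 'X%:P = tofrac 'X%:P / tofrac 'X.
Proof. by rewrite /at_infinity /= horner_morphC /= horner_morphX. Qed.

Lemma at_infinityY : at_infinity 'X = (tofrac 'X)^-1.
Proof. by rewrite /at_infinity /= horner_morphX. Qed.

Lemma at_infinity_monomial (k : K) i j :
  at_infinity (k%:P%:P * ('X%:P ^+ j * 'X ^+ i)) =
  tofrac k%:P%:P * ((tofrac 'X%:P / tofrac 'X) ^+ j * (tofrac 'X)^-1 ^+ i).
Proof.
rewrite rmorphM [_ ('X%:P ^+ j * _)]rmorphM !rmorphXn.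
congr (_ * (_ ^+ _ * _ ^+ _)).
- exact: at_infinityC.
- exact: at_infinityX.
- exact: at_infinityY.
Qed.

Lemma tofracX_neq0 : tofrac 'X != 0 :> L.
Proof. by rewrite tofrac_eq0 polyX_eq0. Qed.

Lemma chart_infinity_homogenize g :
  tofrac (chart (None : point a b c) (homogenize g)) =
  tofrac 'X ^+ tdeg g * at_infinity g.
Proof.
rewrite chart_homogenize (big_morph _ (@tofracD _) (tofrac0 _)).
rewrite [X in at_infinity X]poly2_sum rmorph_sum mulr_sumr.
apply: eq_bigr => i _.
rewrite (big_morph _ (@tofracD _) (tofrac0 _)) rmorph_sum mulr_sumr.
(* The truncated difference [tdeg g - (i + j)] is known to be exact only where the coefficient is
   nonzero. *)
apply: eq_bigr => j _; have [->|gij] := eqVneq (g`_i`_j) 0.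
  by rewrite !polyC0 !mul0r !rmorph0 mulr0.
rewrite at_infinity_monomial !chartE expr1n mulr1 !tofracM !tofracXn.
have {2}-> : tdeg g = (tdeg g - (i + j) + (i + j))%N by rewrite subnK ?tdeg_ge.
exact: dehomogenize_monomial tofracX_neq0.
Qed.

End Charts.

(** * Uniformizers on the cubic *)

Section Uniformizers.

Variable K : fieldType.

(** The factor theorem is applied to each coefficient, because [x] is the inner variable. *)
Lemma map_horner_eval_eq0 (x0 : K) (A : {poly {poly K}}) :
  map_poly (horner_eval x0) A = 0 ->
  exists A', A = ('X - x0%:P)%:P * A'.
Proof.
move=> A0; exists (map_poly (fun q => q %/ ('X - x0%:P)) A).
apply/polyP => i; rewrite coefCM coef_map_id0 ?div0p // mulrC divpK //.
have := congr1 (fun q : {poly K} => q`_i) A0.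
by rewrite coef_map coef0 /= /horner_eval dvdp_XsubCl => /eqP.
Qed.

(** Since [y - p.2] lies in [(t)], so does the whole maximal ideal. If [F] vanished on the line
    [x = p.1], restricting the relation [y_ge] to that line would kill its denominator [B], a unit
    at [p]; hence [F] is nonzero there, and [t] can be cancelled modulo [F]. *)
Lemma uniformizer_x (F : {poly {poly K}}) (p : K * K) :
  eval2 p F = 0 -> val_ge F ('X - p.1%:P)%:P p ('X - p.2%:P%:P) 1 ->
  uniformizer F ('X - p.1%:P)%:P p.
Proof.
move=> pF y_ge.
pose ev := map_poly (horner_eval p.1) : {rmorphism {poly {poly K}} -> {poly K}}.
have ev_t : ev ('X - p.1%:P)%:P = 0.
  by rewrite /ev /= map_polyC /= /horner_eval !hornerE subrr polyC0.
have F0 : ev F != 0.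
  apply/eqP => F0; case: y_ge => A [B [C [B0 e]]]; apply: B0.
  have /eqP : ev ('X - p.2%:P%:P) * ev B = 0.
    by rewrite -rmorphM e rmorphD !rmorphM F0 ev_t !mul0r addr0.
  rewrite mulf_eq0 rmorphB /= map_polyX map_polyC polyXsubC_eq0 /= => /eqP B0.
  by rewrite /eval2 -[LHS]/(horner_eval _ _) -horner_map B0 horner0.
split=> //; first by left.
  move=> h /eval2_eq0_decomp [u [v ->]].
  by apply: val_geD; apply: val_geMr => //; apply: (val_ge_self _ _ _ 1).
move=> U A e; have [A' eA] : exists A', A = ('X - p.1%:P)%:P * A'.
  apply: map_horner_eval_eq0; apply: (mulfI F0); rewrite mulr0.
  by rewrite -[LHS](rmorphM ev) -e rmorphM ev_t mul0r.
exists A'; apply: (mulfI (_ : ('X - p.1%:P)%:P != 0)).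
  by rewrite polyC_eq0 polyXsubC_eq0.
by rewrite e eA mulrCA.
Qed.

Lemma uniformizer_y (F : {poly {poly K}}) (p : K * K) :
  eval2 p F = 0 -> val_ge F ('X - p.2%:P%:P) p ('X - p.1%:P)%:P 1 ->
  uniformizer F ('X - p.2%:P%:P) p.
Proof.
move=> pF x_ge.
have F0 : F.[p.2%:P] != 0.
  apply/eqP => F0; case: x_ge => A [B [C [B0 e]]]; apply: B0.
  have /eqP : ('X - p.1%:P) * B.[p.2%:P] = 0.
    rewrite -[_ - _](hornerC _ p.2%:P) -hornerM e !hornerE F0.
    by rewrite subrr !mul0r addr0.
  by rewrite /eval2 mulf_eq0 polyXsubC_eq0 /= => /eqP ->; rewrite horner0.
split=> //; first by right.
  move=> h /eval2_eq0_decomp [u [v ->]].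
  by apply: val_geD; apply: val_geMr => //; apply: (val_ge_self _ _ _ 1).
move=> U A e; have /factor_theorem [A' eA] : root A p.2%:P.
  apply/eqP; apply: (mulfI F0); rewrite mulr0 -hornerM -e.
  by rewrite hornerM hornerXsubC subrr mul0r.
exists A'; apply: (mulfI (_ : 'X - p.2%:P%:P != 0)).
  by rewrite polyXsubC_eq0.
by rewrite e eA mulrA mulrC.
Qed.

End Uniformizers.

(** * Local coordinates on the cubic, and the orders of [x - x0] and [Z] *)

Section CubicCharts.

Variables (K : fieldType) (a b c : K).
Hypothesis two_neq0 : 2%:R != 0 :> K.
Hypothesis E_smooth : smooth_curve (weierstrass a b c).

Local Notation O := (None : point a b c).
Local Notation W := (weierstrass a b c).

Lemma chart_affine_weierstrass (p : affpoint a b c) :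
  chart (Some p) W = 'X^2 - (cubic a b c)%:P.
Proof.
rewrite /weierstrass !chartE !mulr1 expr1n !mulr1 /cubic; congr (_ - _).
by rewrite -!mul_polyC; ring.
Qed.

Lemma chart_infinity_weierstrass : chart O W =
  'X - ('X%:P ^+ 3 + a%:P%:P * ('X%:P ^+ 2 * 'X)
        + b%:P%:P * ('X%:P * 'X^2) + c%:P%:P * 'X^3).
Proof. by rewrite /weierstrass !chartE expr1n mul1r. Qed.

Lemma smooth_affine (p : affpoint a b c) : (val p).2 = 0 ->
  3%:R * (val p).1 ^+ 2 + 2%:R * a * (val p).1 + b != 0.
Proof.
case: p => -[x y] /= pE y0; apply/eqP => f'0.
have fx : x ^+ 3 + a * x ^+ 2 + b * x + c = 0.
  by move: pE => /eqP /=; rewrite y0 /cubic !hornerE expr0n => <-.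
pose v (i : 'I_3) : K := [:: x; 0; 1]`_i.
have vX k : (k < 3)%N -> ('X_(inord k) : {mpoly K[3]}).@[v] = [:: x; 0; 1]`_k.
  by move=> k3; rewrite mevalXU /v inordK.
have v0 : exists i, v i <> 0.
  by exists (inord 2); rewrite /v inordK //=; apply/eqP/oner_neq0.
have vW : W.@[v] = 0.
  rewrite /weierstrass /pX /pY /pZ.
  rewrite !(mevalB, mevalD, mevalZ, mevalM, rmorphXn) /= !vX //=.
  by rewrite -[RHS]oppr0 -[in RHS]fx; ring.
case: (E_smooth (v := v) v0 vW) => i; apply.
have dX (k : 'I_3) : ('X_k : {mpoly K[3]})^`M(i) = (k == i)%:R%:MP.
  rewrite mderivX mnm1E; case: eqP => [->|_]; last by rewrite scale0r mpolyC0.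
  have := addmK U_(i)%MM 0%MM; rewrite add0m => ->.
  by rewrite mpolyX0 scale1r mpolyC1.
rewrite /weierstrass /pX /pY /pZ !exprS !expr0.
rewrite !(mderivB, mderivD, mderivZ, mderivM, dX) mderivC.
rewrite !(mevalB, mevalD, mevalZ, mevalM, mevalC, meval1, meval0) !vX //=.
(* With the Kronecker deltas as unknowns, all three partial derivatives are treated at once: at
   [(x, 0, 1)] they are [-f'], [0] and, by Euler's relation, [-(3 f - x f')]. *)
move: (inord 0 == i)%:R (inord 1 == i)%:R (inord 2 == i)%:R => d0 d1 d2.
transitivity (- (d0 * (3%:R * x ^+ 2 + 2%:R * a * x + b)
  + d2 * (3%:R * (x ^+ 3 + a * x ^+ 2 + b * x + c)
          - x * (3%:R * x ^+ 2 + 2%:R * a * x + b)))); first by ring.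
by rewrite f'0 fx; ring.
Qed.

(** The difference quotient of [f] at [x0]; its value at [x0] is [f'(x0)]. *)
Definition cubic_quotient (x0 : K) : {poly K} :=
  'X^2 + x0%:P * 'X + x0%:P ^+ 2 + a%:P * ('X + x0%:P) + b%:P.

Lemma cubic_sub_horner (x0 : K) :
  cubic a b c = ((cubic a b c).[x0])%:P + ('X - x0%:P) * cubic_quotient x0.
Proof.
rewrite /cubic_quotient /cubic !hornerE /= -!mul_polyC.
by ring.
Qed.

(** The function [y] at the branch points of [x], where the tangent is vertical, [x - x_P] at other
    affine points, and [X/Y] at [O]. *)
Definition local_coord (P : point a b c) : {poly {poly K}} :=
  let q := chart_coord P in
  if (P != None) && (q.2 == 0) then 'X - q.2%:P%:P else ('X - q.1%:P)%:P.

Definition on_E_val P := val_at (chart P W) (local_coord P) (chart_coord P).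
Definition on_E_val_ge P := val_ge (chart P W) (local_coord P) (chart_coord P).

(** On [E] near [O], [z] times a unit equals the cube of the local coordinate. *)
Lemma weierstrass_infinity_z :
  'X * (1 - a%:P%:P * 'X%:P ^+ 2 - b%:P%:P * 'X%:P * 'X - c%:P%:P * 'X^2) =
  'X%:P ^+ 3 + chart O W.
Proof. by rewrite chart_infinity_weierstrass; ring. Qed.

Lemma on_E_val_z : on_E_val O 'X 3.
Proof.
exists 1, (1 - a%:P%:P * 'X%:P ^+ 2 - b%:P%:P * 'X%:P * 'X - c%:P%:P * 'X^2), 1.
rewrite weierstrass_infinity_z /local_coord /= subr0 !mulr1.
split=> //; apply/eqP; rewrite !eval2E ?hornerE ?expr0n /= ?(mulr0, subr0);
  exact: oner_neq0.
Qed.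

Lemma uniformizer_chart P :
  uniformizer (chart P W) (local_coord P) (chart_coord P).
Proof.
case: P => [p|]; last first.
  apply: uniformizer_x.
    rewrite chart_infinity_weierstrass !eval2E !hornerE /=.
    by rewrite ?expr0n /= !(mulr0, addr0, oppr0).
  apply: (@val_ge_le _ _ _ _ _ 3) => //.
  have -> : 'X - (chart_coord O).2%:P%:P = 'X :> {poly {poly K}}.
    by rewrite /= !polyC0 subr0.
  exact: (val_at_ge on_E_val_z).
case: p => -[x y] xyE; have /= f'0 := @smooth_affine (exist _ (x, y) xyE).
rewrite /local_coord chart_affine_weierstrass /=.
have /= /eqP yE := xyE.
have pF : eval2 (x, y) ('X^2 - (cubic a b c)%:P) = 0.
  by rewrite eval2D eval2N eval2_exp eval2X eval2C /= yE subrr.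
have fE := cubic_sub_horner x; rewrite -yE in fE.
have evq : (cubic_quotient x).[x] = 3%:R * x ^+ 2 + 2%:R * a * x + b.
  by rewrite /cubic_quotient !hornerE /=; ring.
case: (eqVneq y 0) => [y0|y0].
  apply: (@uniformizer_y _ _ (x, y)) => //=.
  (* Here [f(x0) = 0], so on the curve [(x - x0) q = y^2], where [q(x0) = f'(x0)] is nonzero by
     smoothness. *)
  exists ('X), (cubic_quotient x)%:P, (-1); split.
    by rewrite eval2E /= evq; apply/eqP/f'0.
  rewrite -polyCM expr1 fE y0 expr0n /= !polyC0; ring.
apply: (@uniformizer_x _ _ (x, y)) => //=.
(* On the curve [(y - y0) (y + y0) = (x - x0) q], and [y + y0] takes the nonzero value [2 y0]. *)
exists ((cubic_quotient x)%:P), ('X + y%:P%:P), 1; split.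
  rewrite !eval2E !hornerE /= -mulr2n -mulr_natl; apply/eqP.
  by rewrite mulf_neq0.
by rewrite fE; ring.
Qed.

Lemma on_E_val_x_ne (p : affpoint a b c) (x0 : K) : (val p).1 != x0 ->
  on_E_val (Some p) ('X - x0%:P)%:P 0.
Proof.
by move=> px; apply: val_at_unit; apply/eqP; rewrite eval2E !hornerE subr_eq0.
Qed.

Lemma on_E_val_x_eq (p : affpoint a b c) : (val p).2 != 0 ->
  on_E_val (Some p) ('X - (val p).1%:P)%:P 1.
Proof.
by rewrite /on_E_val /local_coord /= => /negPf ->; apply: (val_at_self _ _ _ 1).
Qed.

Lemma on_E_val_x_branch (p : affpoint a b c) : (val p).2 = 0 ->
  on_E_val (Some p) ('X - (val p).1%:P)%:P 2.
Proof.
move=> y0; have f'0 := smooth_affine y0; have := valP p.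
rewrite /on_E_val /local_coord /= y0 eqxx chart_affine_weierstrass => /eqP yE.
have fE := cubic_sub_horner (val p).1; rewrite -yE expr0n /= polyC0 in fE.
exists 1, (cubic_quotient (val p).1)%:P, (-1); split.
- by rewrite eval2_1; apply/eqP/oner_neq0.
- apply/eqP; rewrite eval2E /= /cubic_quotient !hornerE /=.
  by apply: contraNneq f'0 => <-; apply/eqP; ring.
by rewrite [X in (_ - X%:P) * _]fE !polyC0; ring.
Qed.

(** This is the homogenized [x - x0] in the chart at [O]: subtracting a multiple of [z], of order 3,
    from the local coordinate leaves order 1. *)
Lemma on_E_val_line_infinity (x0 : K) :
  on_E_val O ('X%:P - x0%:P%:P * 'X) 1.
Proof.
pose u := 1 - a%:P%:P * 'X%:P ^+ 2 - b%:P%:P * 'X%:P * 'X - c%:P%:P * 'X^2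
  : {poly {poly K}}.
exists (u - x0%:P%:P * 'X%:P ^+ 2), u, (- x0%:P%:P).
rewrite /local_coord /= polyC0 subr0; split.
- apply/eqP; rewrite /u !eval2E ?hornerE ?expr0n /= ?(mulr0, subr0).
  exact: oner_neq0.
- apply/eqP; rewrite /u !eval2E ?hornerE ?expr0n /= ?(mulr0, subr0).
  exact: oner_neq0.
rewrite mulrBl -mulrA [X in _ - _ * X]weierstrass_infinity_z; ring.
Qed.

End CubicCharts.

(** * Divisibility by x - x_d, and the chart at infinity *)

Lemma weierstrass_dehomogenize (L : fieldType) (a b c x z : L) : z != 0 ->
  z - (x ^+ 3 + a * (x ^+ 2 * z) + b * (x * z ^+ 2) + c * z ^+ 3) =
  z ^+ 3 * (z^-1 ^+ 2 - ((x / z) ^+ 3 + a * (x / z) ^+ 2 + b * (x / z) + c)).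
Proof. by move=> z0; field. Qed.

Section ContactCurve.

Variables (K : fieldType) (a b c : K).
Hypothesis two_neq0 : 2%:R != 0 :> K.
Hypothesis E_smooth : smooth_curve (weierstrass a b c).

Local Notation O := (None : point a b c).
Local Notation W := (weierstrass a b c).
Implicit Types (P Q : point a b c) (D : divisor a b c) (g : {poly {poly K}}).

Let unif P := uniformizer_chart two_neq0 E_smooth P.

Lemma has_divisor_val_affine g D (p : affpoint a b c) : has_divisor g D ->
  exists2 m : nat, on_E_val (Some p) g m & coeff (Some p) D = m%:Z.
Proof.
move=> /(_ (Some p)) [i [j [/(ord_on_val_at (unif _)) gi]]].
move=> /(ord_on_val_at (unif _)) zj ->; exists i.
  by move: gi; rewrite chart_affine_homogenize.
suff -> : j = 0%N by rewrite subr0.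
apply: (val_at_uniq (unif _) zj); rewrite chartXn chart_pZ expr1n.
by apply: val_at_unit; rewrite eval2_1; apply/eqP/oner_neq0.
Qed.

Lemma has_divisor_val_infinity g D : has_divisor g D ->
  exists2 m : nat, on_E_val O (chart O (homogenize g)) m
                 & coeff O D = m%:Z - (3 * tdeg g)%:Z.
Proof.
move=> /(_ O) [i [j [/(ord_on_val_at (unif _)) gi]]].
move=> /(ord_on_val_at (unif _)) zj ->; exists i => //.
suff -> : j = (3 * tdeg g)%N by [].
apply: (val_at_uniq (unif _) zj); rewrite chartXn chart_pZ mulnC.
exact: (val_atX _ (on_E_val_z _ _ _)).
Qed.

(** The zeros of [x - x_q] are [q] and its image under the involution; both booleans hold exactly
    when the two points coincide, a branch point of [x], where the order is 2. *)
Lemma on_E_val_x (q p : affpoint a b c) :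
  on_E_val (Some p) ('X - (val q).1%:P)%:P
    ((Some q == Some p) + (iota_E (Some q) == Some p)).
Proof.
rewrite !(inj_eq (@Some_inj _)) -!val_eqE /=.
case: q p => -[xq yq] qE [[xp yp] pE] /=; rewrite !xpair_eqE.
have [xqp|xqp] := eqVneq xq xp; last first.
  by apply: on_E_val_x_ne; rewrite eq_sym.
subst xp.
have /eqP : (yq - yp) * (yq + yp) = 0.
  by rewrite -subr_sqr (eqP qE) (eqP pE) subrr.
rewrite /= mulf_eq0 subr_eq0 addr_eq0 -eqr_oppLR => ypq.
have [y0|y0] := eqVneq yp 0.
  have yq0 : yq = 0 by move: ypq; rewrite y0 oppr_eq0 orbb => /eqP.
  subst yp yq; rewrite oppr0 eqxx.
  exact: on_E_val_x_branch.
suff -> : ((yq == yp) + (- yq == yp))%N = 1%N by apply: on_E_val_x_eq.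
have [yqp|/negPf yqp] := eqVneq yq yp; last by move: ypq; rewrite yqp /= => ->.
rewrite yqp -subr_eq0 -opprD oppr_eq0 -mulr2n -mulr_natl mulf_eq0.
by rewrite (negPf two_neq0) (negPf y0).
Qed.

(** If [y_q] is nonzero, both [c0 + c1 y_q] and [c0 - c1 y_q] vanish at [x_q], and 2 is invertible.
    If [y_q = 0], the value at [q] gives [c0(x_q) = 0], so [c0] has order at least 2; then so has
    [c1 y], and as [y] has order 1, [c1] vanishes too. *)
Lemma linear_in_y_root (q : affpoint a b c) (c0 c1 : {poly K}) :
  let e := (1 + (iota_E (Some q) == Some q))%N in
  on_E_val_ge (Some q) (c0%:P + c1%:P * 'X) e ->
  on_E_val_ge (iota_E (Some q)) (c0%:P + c1%:P * 'X) e ->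
  root c0 (val q).1 /\ root c1 (val q).1.
Proof.
move=> e ge_q ge_iq; rewrite /root.
have /= := val_ge_eval2 (unif _) (ltn0Sn _) ge_iq.
have /= := val_ge_eval2 (unif _) (ltn0Sn _) ge_q.
rewrite !eval2E /=; set u := c0.[_]; set v := c1.[_] => evq eviq.
have [y0|y0] := eqVneq (val q).2 0; last first.
  have u0 : u = 0.
    apply: (mulfI two_neq0); rewrite mulr0 mulr_natl mulr2n.
    by have := congr2 +%R evq eviq; rewrite addr0 => <-; ring.
  split; first exact/eqP.
  by move/eqP: evq; rewrite u0 add0r mulf_eq0 (negPf y0) orbF.
have u0 : u = 0 by move: evq; rewrite [sval _]/(val q) y0 mulr0 addr0.
split; first exact/eqP.
have y0' : (sval q).2 = 0 := y0.
have e2 : e = 2%N.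
  rewrite /e; suff -> : iota_E (Some q) == Some q by [].
  rewrite (inj_eq (@Some_inj _)) -val_eqE /= y0' oppr0.
  by case: (sval q) y0' => x y /= ->.
have /factor_theorem [r c0E] : root c0 (val q).1 by apply/eqP.
have ge_y : on_E_val_ge (Some q) (c1%:P * 'X) (1 + 1).
  have -> : c1%:P * 'X = (c0%:P + c1%:P * 'X)
      + ('X - (val q).1%:P)%:P * (- r)%:P.
    by rewrite c0E; ring.
  apply: val_geD; first by move: ge_q; rewrite e2.
  exact/val_geMr/val_at_ge/on_E_val_x_branch.
have val_y : on_E_val (Some q) 'X 1.
  have -> : 'X = local_coord (Some q) ^+ 1.
    by rewrite /local_coord /= y0' eqxx !polyC0 subr0.
  exact: val_at_self.
have := val_ge_eval2 (unif _) (ltn0Sn _) (val_ge_div (unif _) ge_y val_y).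
by rewrite eval2E /= => /eqP.
Qed.

Lemma linear_in_y_dvd (q : affpoint a b c) (n : nat) (c0 c1 : {poly K}) :
  let e := (1 + (iota_E (Some q) == Some q))%N in
  on_E_val_ge (Some q) (c0%:P + c1%:P * 'X) (n * e) ->
  on_E_val_ge (iota_E (Some q)) (c0%:P + c1%:P * 'X) (n * e) ->
  exists g0 g1 : {poly K},
    c0%:P + c1%:P * 'X =
    (g0%:P + g1%:P * 'X) * ('X - (val q).1%:P)%:P ^+ n.
Proof.
move=> e; elim: n c0 c1 => [|n IH] c0 c1 ge_q ge_iq.
  by exists c0, c1; rewrite mulr1.
have e_le : (e <= n.+1 * e)%N by rewrite mulSn leq_addr.
have [] := linear_in_y_root (val_ge_le e_le ge_q) (val_ge_le e_le ge_iq).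
move=> /factor_theorem [c0' c0E] /factor_theorem [c1' c1E].
have cE : c0%:P + c1%:P * 'X =
    (c0'%:P + c1'%:P * 'X) * ('X - (val q).1%:P)%:P.
  by rewrite c0E c1E !polyCM; ring.
(* The factor [x - x_q] has order exactly [e] at both points, so removing it lowers both bounds by
   [e]. *)
have x_q := on_E_val_x q q; rewrite eqxx -/e in x_q.
have x_iq : on_E_val (iota_E (Some q)) ('X - (val q).1%:P)%:P e.
  have := on_E_val_x q (exist _ ((val q).1, - (val q).2) (inv_on_curve q)).
  by rewrite -/(iota_E (Some q)) eqxx addnC [Some q == _]eq_sym.
rewrite cE mulSn addnC in ge_q ge_iq.
have [] := IH c0' c1' (val_ge_div (unif _) ge_q x_q)
                      (val_ge_div (unif _) ge_iq x_iq).
by move=> g0 [g1 gE]; exists g0, g1; rewrite cE gE exprSr mulrA.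
Qed.

Lemma cubic_at_infinity :
  tofrac (chart O W) =
  tofrac 'X ^+ 3 * at_infinity K ('X^2 - (cubic a b c)%:P).
Proof.
have -> : 'X^2 - (cubic a b c)%:P = 'X^2 - ('X%:P ^+ 3 + a%:P%:P * 'X%:P ^+ 2
    + b%:P%:P * 'X%:P + c%:P%:P) :> {poly {poly K}}.
  by rewrite /cubic -!mul_polyC; ring.
rewrite chart_infinity_weierstrass.
rewrite [at_infinity K _]rmorphB [at_infinity K (_ + _)]rmorphD.
rewrite [at_infinity K (_ + _)]rmorphD [at_infinity K (_ + _)]rmorphD.
rewrite [at_infinity K (_ * 'X%:P ^+ 2)]rmorphM.
rewrite [at_infinity K (_ * 'X%:P)]rmorphM.
rewrite ![at_infinity K (_ ^+ _)]rmorphXn.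
rewrite !at_infinityC at_infinityX at_infinityY.
rewrite !(tofracB, tofracD, tofracXn, tofracM).
exact (weierstrass_dehomogenize _ _ _ _ (tofracX_neq0 K)).
Qed.

Lemma line_at_infinity (x0 : K) :
  tofrac ('X%:P - x0%:P%:P * 'X) =
  tofrac 'X * at_infinity K ('X - x0%:P)%:P.
Proof.
rewrite polyCB [at_infinity K _]rmorphB at_infinityC at_infinityX.
rewrite tofracB tofracM mulrBr; congr (_ - _); last exact: mulrC.
by rewrite mulrC divfK ?tofracX_neq0.
Qed.

(** Each factor receives the power of [z] clearing its denominators; the extra powers balance the
    two sides without subtracting exponents. *)
Lemma dehomogenize_relation (L : comNzRingType) (z B X Q w G l : L)
    (n tb tx tq tg : nat) :
  B ^+ n * X = Q * w + G * l ^+ n ->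
  (z ^+ tb * B) ^+ n * (z ^+ tx * X) * z ^+ (tq + 3 + tg + n) =
  z ^+ (n * tb + tx) *
    ((z ^+ tq * Q) * (z ^+ 3 * w) * z ^+ (tg + n)
     + (z ^+ tg * G) * (z * l) ^+ n * z ^+ (tq + 3)).
Proof.
move=> e; rewrite !exprMn -exprM [(tb * n)%N]mulnC.
transitivity (z ^+ (n * tb + tx) * z ^+ (tq + 3 + tg + n) * (B ^+ n * X)).
  by rewrite !exprD; ring.
by rewrite e !exprD; ring.
Qed.

Lemma infinity_relation (be xi q g : {poly {poly K}}) (x0 : K) (n : nat) :
  let ch h := chart O (homogenize h) in let F := chart O W in
  be ^+ n * xi = q * ('X^2 - (cubic a b c)%:P) + g * ('X - x0%:P)%:P ^+ n ->
  ch be ^+ n * ch xi * 'X ^+ (tdeg q + 3 + tdeg g + n) =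
  'X ^+ (n * tdeg be + tdeg xi) *
    (ch q * F * 'X ^+ (tdeg g + n)
     + ch g * ('X%:P - x0%:P%:P * 'X) ^+ n * 'X ^+ (tdeg q + 3)).
Proof.
move=> ch F e; apply/eqP; rewrite -tofrac_eq; apply/eqP.
(* The line is generalized so that the morphism rules below do not expand it. *)
move: (line_at_infinity x0); move: ('X%:P - x0%:P%:P * 'X) => l lE.
rewrite !(tofracM, tofracD, tofracXn) !chart_infinity_homogenize.
rewrite cubic_at_infinity lE; apply: dehomogenize_relation.
have := congr1 (at_infinity K) e.
rewrite rmorphM [at_infinity K (_ ^+ n)]rmorphXn.
rewrite [at_infinity K (_ + g * _)]rmorphD.
rewrite [at_infinity K (g * _)]rmorphM [at_infinity K (q * _)]rmorphM.
by rewrite [at_infinity K (_ ^+ n)]rmorphXn.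
Qed.

End ContactCurve.

(** * The contact curve *)

Lemma homogenize_homog (K : fieldType) (g : {poly {poly K}}) :
  homogenize g \is (tdeg g).-homog.
Proof.
rewrite /homogenize; apply: rpred_sum => i _; apply: rpred_sum => j _.
have [->|gij] := eqVneq (g`_i`_j) 0; first by rewrite scale0r rpred0.
apply: dhomogZ; set e := (tdeg g - (i + j))%N.
have -> : tdeg g = (1 * j + 1 * i + 1 * e)%N.
  by rewrite !mul1n [(j + i)%N]addnC subnKC ?tdeg_ge.
have X_homog (k : 'I_3) l : ('X_k : {mpoly K[3]}) ^+ l \is (1 * l).-homog.
  by apply: dhomogMn; rewrite dhomogX /= mdeg1.
by apply: dhomogM (X_homog _ _); apply: dhomogM; apply: X_homog.
Qed.

Lemma coeff_sum_points (T : choiceType) (d : nat) (P : 'I_d -> T) (Q : T) :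
  coeff Q (\sum_(i < d) << P i >> : {freeg T}) =
  (\sum_(i < d) (P i == Q))%N%:Z.
Proof.
rewrite (big_morph _ (coeffD Q) (coeff0 _ Q)) (big_morph Posz PoszD (erefl 0)).
by apply: eq_bigr => i _; rewrite coeffU mul1r natz.
Qed.

Section WeakContact.

Variables (K : fieldType) (a b c : K).
Hypothesis two_neq0 : 2%:R != 0 :> K.
Hypothesis E_smooth : smooth_curve (weierstrass a b c).
Variables (d n : nat) (P : 'I_d -> point a b c) (Pd : affpoint a b c).
Hypothesis P_neqO : forall i, P i <> None.
Variables b0 b1 xi0 xi1 c0 c1 : {poly K}.

Local Notation O := (None : point a b c).
Local Notation W := (weierstrass a b c).
Local Notation bd := (b0%:P + b1%:P * 'X).
Local Notation xi := (xi0%:P + xi1%:P * 'X).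
Local Notation line := ('X - (val Pd).1%:P)%:P.

Hypothesis div_b : has_divisor bd
  (\sum_(i < d) << P i >> + << iota_E (Some Pd) >>
     - << (d.+1)%:Z *g O >> : divisor a b c).
Hypothesis div_xi : has_divisor xi
  (<< n%:Z *g (Some Pd : point a b c) >> - << n%:Z *g O >> : divisor a b c).

Let unif P := uniformizer_chart two_neq0 E_smooth P.

Let mult (p : affpoint a b c) := (\sum_(i < d) (P i == Some p))%N.

Lemma val_b_affine (p : affpoint a b c) :
  on_E_val (Some p) bd (mult p + (iota_E (Some Pd) == Some p)).
Proof.
have [m bm] := has_divisor_val_affine two_neq0 E_smooth p div_b.
rewrite coeffB coeffD coeff_sum_points !coeffU mulr0 subr0 mul1r natz.
by rewrite -PoszD => -[->].
Qed.

Lemma val_xi_affine (p : affpoint a b c) :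
  on_E_val (Some p) xi (n * (Some Pd == Some p)).
Proof.
have [m xm] := has_divisor_val_affine two_neq0 E_smooth p div_xi.
rewrite coeffB !coeffU mulr0 subr0 natz -PoszM => -[e].
by rewrite e.
Qed.

Lemma val_b_infinity : exists2 m : nat,
  on_E_val O (chart O (homogenize bd)) m & (m + d.+1 = 3 * tdeg bd)%N.
Proof.
have [m bm] := has_divisor_val_infinity two_neq0 E_smooth div_b.
rewrite coeffB coeffD coeff_sum_points !coeffU mulr1 mulr0 addr0.
rewrite big1 => [e|i _]; last by apply/eqP; rewrite eqb0; apply/eqP/P_neqO.
exists m => //; lia.
Qed.

Lemma val_xi_infinity : exists2 m : nat,
  on_E_val O (chart O (homogenize xi)) m & (m + n = 3 * tdeg xi)%N.
Proof.
have [m xm] := has_divisor_val_infinity two_neq0 E_smooth div_xi.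
rewrite coeffB !coeffU mulr1 mulr0 => e.
exists m => //; lia.
Qed.

Variable q : {poly {poly K}}.
Hypothesis NF_c :
  bd ^+ n * xi = q * ('X^2 - (cubic a b c)%:P) + (c0%:P + c1%:P * 'X).

Lemma val_c_affine (p : affpoint a b c) :
  on_E_val (Some p) (c0%:P + c1%:P * 'X)
    (n * (mult p + (iota_E (Some Pd) == Some p)) + n * (Some Pd == Some p)).
Proof.
have : on_E_val (Some p) (bd ^+ n * xi)
    (n * (mult p + (iota_E (Some Pd) == Some p)) + n * (Some Pd == Some p)).
  by apply: val_atM (val_xi_affine p); apply: val_atX; apply: val_b_affine.
apply: val_at_congr; rewrite chart_affine_weierstrass NF_c addrC; reflexivity.
Qed.

(** At [P_d] the factor [xi] contributes order [n], at its image [b^n] does; if the two coincide,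
    the contributions add up to [2 n]. *)
Lemma c_divisible : exists g0 g1 : {poly K},
  c0%:P + c1%:P * 'X = (g0%:P + g1%:P * 'X) * line ^+ n.
Proof.
apply: (linear_in_y_dvd two_neq0 E_smooth).
  apply: val_ge_le (val_at_ge (val_c_affine Pd)).
  by rewrite -mulnDr eqxx leq_mul2l addnC leq_add2r leq_addl orbT.
apply: val_ge_le (val_at_ge (val_c_affine _)).
rewrite -mulnDr -/(iota_E (Some Pd)) eqxx [Some Pd == _]eq_sym.
by rewrite leq_mul2l leq_add2r leq_addl orbT.
Qed.

Variable g : {poly {poly K}}.
Hypothesis gE : c0%:P + c1%:P * 'X = g * line ^+ n.

Lemma val_g_affine (p : affpoint a b c) : on_E_val (Some p) g (n * mult p).
Proof.
have := val_c_affine p; rewrite gE => g_val.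
have [k gk] := val_at_div (unif _) g_val
  (val_atX n (on_E_val_x two_neq0 E_smooth Pd p)).
by rewrite -mulnDr -addnA [X in (_ + X)%N]addnC mulnDr => /addIn ->.
Qed.

Lemma val_g_infinity : exists2 k : nat,
  on_E_val O (chart O (homogenize g)) k & (k + n * d = 3 * tdeg g)%N.
Proof.
have [mb bm mbE] := val_b_infinity; have [mx xm mxE] := val_xi_infinity.
have zX k : on_E_val O ('X ^+ k) (k * 3).
  by apply: val_atX; apply: on_E_val_z.
have e := NF_c; rewrite gE in e.
have := val_atM (val_atM (val_atX n bm) xm) (zX (tdeg q + 3 + tdeg g + n)%N).
(* The multiple of the curve equation is isolated so that [val_at_congr] can discard it. *)
have split_curve (L : comNzRingType) (z u F v w l s : L) :
    z * (u * F * v + w * l * s) = w * (l * s * z) + (z * u * v) * F by ring.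
rewrite (infinity_relation e) split_curve => rel.
have {rel} gv := val_at_congr (erefl _) rel.
have [k gk kE] := val_at_div (unif O) gv (val_atM (val_atM
  (val_atX n (on_E_val_line_infinity a b c (val Pd).1)) (zX _)) (zX _)).
exists k => //.
(* Order balance at [O]: [b^n] gives [-n(d+1)], [xi] gives [-n], and dividing by [(x - x_d)^n] adds
   [2n], for a total of [-nd]. The product with [n] is supplied for the arithmetic. *)
have : (n * (mb + d.+1) = n * (3 * tdeg bd))%N by rewrite mbE.
move: kE mxE; clear; nia.
Qed.

Lemma g_cuts_out : cuts_out (homogenize g)
  ((\sum_(i < d) << P i >>) *+ n
     + << (3 * tdeg g)%:Z - (n * d)%:Z *g O >> : divisor a b c).
Proof.
split=> [[Q QE]|[p|]].
(* If the curve contained [E], then [g] would be a multiple of the curve equation near [P_d],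
   against its finite order there. *)
- have := val_g_affine Pd; rewrite -(chart_affine_homogenize Pd g) QE chartM.
  rewrite [chart _ Q * _]mulrC => /(val_at_not_multiple (unif _)).
  move=> /(_ 1 (chart (Some Pd) Q)); rewrite mulr1 eval2_1 => /(_ erefl) /eqP.
  by rewrite oner_eq0.
- exists (n * mult p)%N; split.
    rewrite chart_affine_homogenize.
    exact (val_at_intersection_mult (unif (Some p)) (val_g_affine p)).
  rewrite coeffD coeffMn coeff_sum_points coeffU mulr0 addr0.
  by rewrite -mulr_natl natz -PoszM.
have [k gk kE] := val_g_infinity; exists k; split.
  exact (val_at_intersection_mult (unif O) gk).
rewrite coeffD coeffMn coeff_sum_points coeffU mulr1.
rewrite big1 => [|i _]; last by apply/eqP; rewrite eqb0; apply/eqP/P_neqO.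
by rewrite -kE mul0rn add0r PoszD addrK.
Qed.

Lemma g_weak_contact :
  (0 < n * d)%N -> weak_contact_curve a b c n (homogenize g).
Proof.
move=> nd0; have [k _ kE] := val_g_infinity; split.
  split.
    move=> g0; have [[]] := g_cuts_out; exists 0.
    by rewrite g0 mul0r.
  exists (tdeg g); last exact: homogenize_homog.
  (* The degree is positive because [3 * tdeg g = k + n * d]; the same identity makes the
     multiplicity of [O] below nonnegative. *)
  by rewrite -(ltn_pmul2l (isT : 0 < 3)%N) -kE muln0 addn_gt0 nd0 orbT.
exists [seq P i | i <- enum 'I_d], (3 * tdeg g - n * d)%N.
rewrite big_map big_enum /=.
have -> : (3 * tdeg g - n * d)%N%:Z = (3 * tdeg g)%:Z - (n * d)%:Z.
  by rewrite subzn // -kE leq_addl.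
exact: g_cuts_out.
Qed.

End WeakContact.

Unset Implicit Arguments.

Theorem theorem2p1 (R : realType) (a b c : R[i])
    (E_smooth : smooth_curve (weierstrass a b c))
    (d : nat) (d_ge1 : (1 <= d)%N)
    (P : 'I_d -> point a b c) (P_neqO : forall i, P i <> None)
    (Pd : affpoint a b c)
    (sum_P : \big[@addE _ a b c/None]_(i < d) P i = Some Pd)
    (n : nat) (n_ge2 : (2 <= n)%N) (Pd_order : has_order n (Some Pd))
    (b0 b1 xi0 xi1 : {poly R[i]})
    (div_b : has_divisor (b0%:P + b1%:P * 'X)
       (\sum_(i < d) << P i >> + << iota_E (Some Pd) >>
          - << (d.+1)%:Z *g (None : point a b c) >> : divisor a b c))
    (div_xi : has_divisor (xi0%:P + xi1%:P * 'X)
       (<< n%:Z *g (Some Pd : point a b c) >>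
          - << n%:Z *g (None : point a b c) >> : divisor a b c))
    (c0 c1 : {poly R[i]})
    (NF_c : NF1 (cubic a b c)
              ((b0%:P + b1%:P * 'X) ^+ n * (xi0%:P + xi1%:P * 'X))
            = c0%:P + c1%:P * 'X) :
  exists g : {poly {poly R[i]}},
    [/\ g * ('X - ((val Pd).1)%:P)%:P ^+ n = c0%:P + c1%:P * 'X,
        weak_contact_curve a b c n (homogenize g)
      & cuts_out (homogenize g)
          ((\sum_(i < d) << P i >>) *+ n
             + << (3 * tdeg g)%:Z - (n * d)%:Z *g (None : point a b c) >>
           : divisor a b c)].
Proof.
have two_neq0 : 2%:R != 0 :> R[i] by rewrite Num.Theory.pnatr_eq0.
have [[q bxiE] _] := NF1_spec (cubic a b c)
  ((b0%:P + b1%:P * 'X) ^+ n * (xi0%:P + xi1%:P * 'X)).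
rewrite NF_c in bxiE.
have [g0 [g1 gE]] := c_divisible two_neq0 E_smooth div_b div_xi bxiE.
exists (g0%:P + g1%:P * 'X); split; first by rewrite gE.
  apply: (g_weak_contact two_neq0 E_smooth P_neqO div_b div_xi bxiE gE).
  by rewrite muln_gt0 d_ge1 (ltnW n_ge2).
exact: (g_cuts_out two_neq0 E_smooth P_neqO div_b div_xi bxiE gE).
Qed.
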